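(* There exists a Hausdorff locally convex-solid (real) vector lattice $X$ such that, if $(\hat X,J)$ denotes its topological completion, the image $J(X)$ is regular in $\hat X$ but not order dense in $\hat X$.
   Context: All vector lattices are real; $X_+$ denotes the positive cone. A locally solid vector lattice is a vector lattice with a linear topology having a base of neighborhoods of zero consisting of solid sets ($U$ is solid if $|x|\le |y|$, $y\in U$ imply $x\in U$); it is locally convex-solid if its topology is in addition locally convex (equivalently, it is generated by a family of lattice seminorms, i.e. seminorms $p$ with $|x|\le|y|\Rightarrow p(x)\le p(y)$). A vector sublattice $Y$ of a vector lattice $Z$ is regular in $Z$ if suprema and infima computed in $Y$ are preserved in $Z$; equivalently, every subset of $Y_+$ whose infimum in $Y$ is $0$ also has infimum $0$ in $Z$. It is order dense in $Z$ if for every $z\in Z$ with $z>0$ (i.e. $z\ge 0$, $z\ne 0$) there is $y\in Y$ with $0<y\le z$. Topological completion: for a Hausdorff locally solid vector lattice $X$, its topological completion is the pair $(\hat X, J)$, unique up to isomorphism, where $\hat X$ is a complete (every Cauchy net converges) Hausdorff topological vector space and $J\colon X\to\hat X$ is a linear topological embedding with dense range; $\hat X$ is ordered by taking as positive cone the closure of $J(X_+)$, which makes $\hat X$ a Hausdorff locally solid vector lattice and $J$ a lattice homomorphism. *)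

(* Defs.v *)
From HB Require Import structures.
From mathcomp Require Import all_boot all_order all_algebra.
From mathcomp Require Import all_classical all_reals all_analysis.

Set Implicit Arguments.
Unset Strict Implicit.
Unset Printing Implicit Defensive.

Import Order.TTheory GRing.Theory Num.Theory.
Import numFieldNormedType.Exports.

Local Open Scope classical_set_scope.
Local Open Scope ring_scope.

(* A join of [Order.Lattice] with [GRing.Zmodule] is rejected by
   Hierarchy-Builder (it would have to be declared before [Num.RealDomain]), so
   a partially ordered module is equipped with its binary joins and meets. *)
HB.mixin Record POrderedZmodule_isVectorLattice (R : numDomainType) V
    & Num.POrderedZmodule V & GRing.Lmodule R V := {
  vlat_lerD2r : forall z x y : V, x <= y -> x + z <= y + z ;
  vlat_scaler_ge0 : forall (a : R) (x : V), 0 <= a -> 0 <= x -> 0 <= a *: x ;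
  vjoin : V -> V -> V ;
  vmeet : V -> V -> V ;
  vjoin_lex : forall x y z : V, (vjoin x y <= z) = (x <= z) && (y <= z) ;
  vmeet_gex : forall x y z : V, (z <= vmeet x y) = (z <= x) && (z <= y)
}.

#[short(type="vectorLatticeType")]
HB.structure Definition VectorLattice (R : numDomainType) :=
  {V of Num.POrderedZmodule V & GRing.Lmodule R V
      & POrderedZmodule_isVectorLattice R V}.

(* No compatibility between order and topology is built in: local solidity is
   the predicate [locally_solid] below. *)
#[short(type="topVectorLatticeType")]
HB.structure Definition TopVectorLattice (R : numDomainType) :=
  {V of VectorLattice R V & TopologicalLmodule R V}.

Section vector_lattice.
Context (R : numDomainType) (Z : vectorLatticeType R).
Implicit Types (Y A U : set Z) (x y z : Z).

Definition modulus x : Z := vjoin x (- x).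

Definition solid U := forall x y, modulus x <= modulus y -> U y -> U x.

Definition vector_sublattice Y :=
  [/\ Y 0,
      forall x y, Y x -> Y y -> Y (x + y),
      forall (a : R) x, Y x -> Y (a *: x),
      forall x y, Y x -> Y y -> Y (vjoin x y)
    & forall x y, Y x -> Y y -> Y (vmeet x y)].

Definition supremum_in Y A y :=
  [/\ Y y, ubound A y & forall u, Y u -> ubound A u -> y <= u].

Definition infimum_in Y A y :=
  [/\ Y y, lbound A y & forall u, Y u -> lbound A u -> u <= y].

(* [A] is nonempty because set0 has supremum 0 in the trivial sublattice
   [set 0] but no supremum in a nontrivial Z. *)
Definition regular_sublattice Y :=
  vector_sublattice Y /\
  forall A y, A !=set0 -> A `<=` Y ->
    (supremum_in Y A y -> supremums A y) /\
    (infimum_in Y A y -> infimums A y).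

Definition order_dense Y := forall z, 0 < z -> exists2 y, Y y & 0 < y <= z.

End vector_lattice.

Definition locally_solid (R : numDomainType) (X : topVectorLatticeType R) :=
  forall U : set X, nbhs 0 U ->
    exists V : set X, [/\ nbhs 0 V, solid V & V `<=` U].

Definition locally_convex_space (R : numDomainType)
    (E : topologicalLmodType R) :=
  forall U : set E, nbhs 0 U ->
    exists V : set E, [/\ nbhs 0 V, convex_set V & V `<=` U].

Definition locally_convex_solid (R : numDomainType)
    (X : topVectorLatticeType R) :=
  locally_solid X /\ locally_convex_space X.

(* Completeness for the translation-invariant uniformity of a topological
   vector space, with filters in place of nets. The library's [cauchy] is not
   used: on a [tvsType] the entourages need not be translation-invariant. *)
Definition tvs_cauchy (R : numDomainType) (E : topologicalLmodType R)
    (F : set_system E) :=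
  forall U : set E, nbhs 0 U -> \forall x & y \near F, U (x - y).

Definition tvs_complete (R : numDomainType) (E : topologicalLmodType R) :=
  forall F : set_system E, ProperFilter F -> tvs_cauchy F ->
    exists l : E, F --> l.

(* [X] carries exactly the topology induced by [f]. *)
Definition topological_embedding (S T : topologicalType) (f : S -> T) :=
  injective f /\
  forall U : set S, open U <-> exists2 V : set T, open V & f @^-1` V = U.

(* The order of [Xhat] is determined by its positive cone, hence by the last
   clause; local solidity of [Xhat] and the fact that [J] is a lattice
   homomorphism are consequences when [X] is Hausdorff and locally solid. *)
Definition is_completion (R : numDomainType) (X Xhat : topVectorLatticeType R)
    (J : {linear X -> Xhat}) :=
  [/\ hausdorff_space Xhat,
      tvs_complete Xhat,
      topological_embedding J,
      dense (range J)
    & [set z : Xhat | 0 <= z] = closure (J @` [set x : X | 0 <= x])].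

(* Main.v *)
Require Import Defs.
From HB Require Import structures.
From mathcomp Require Import all_boot all_order all_algebra.
From mathcomp Require Import all_classical all_reals all_analysis.
From mathcomp Require Import borel_hierarchy ring lra.

Set Implicit Arguments.
Unset Strict Implicit.
Unset Printing Implicit Defensive.

Import Order.TTheory GRing.Theory Num.Theory.
Import numFieldNormedType.Exports.

Local Open Scope classical_set_scope.
Local Open Scope ring_scope.

(** Let [X] be the lattice of bounded continuous functions on the real line, [Q]
the rationals, and [P] the irrationals.  Give [X] the topology of uniform
convergence on the sets [S] such that both [S `&` Q] and [S `\` Q] are closed.
The balls of radius [e] on such [S] are convex and solid, so [X] is locally
convex-solid, and it is Hausdorff because singletons are among the [S].

The completion can be taken to be the space of all functions on the line that
are uniformly approximable by [X] on every [S], with the same topology and the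
pointwise order: pointwise limits of Cauchy filters are uniform on every [S]
([uniform_closure_complete]).

Not order dense.  The two closed sets [S `\` Q] and [S `&` Q] are disjoint, so
by Urysohn's lemma some continuous function is 0 on the first one and 1 on the
second one; hence the indicator of [Q] lies in the completion
([approximable_indic]).  A continuous function between 0 and that indicator
vanishes on the dense set [P], hence everywhere ([Cb_not_order_dense]).

Regular.  An element of the completion is continuous along [Q] at each
rational and along [P] at each irrational ([approximable_near]), since a
sequence in [Q] converging in [Q] forms, with its limit, one of the sets [S].
So if a lower bound [z] of a family of continuous functions exceeds at some
point the infimum [y] of the family in [X], then it exceeds [y] by a positive
constant on the trace of an open set [U] on [Q] or on [P].  As that trace is
dense in [U], all members of the family exceed [y] by this constant on the
whole of [U], and then [y] plus a small bump supported in [U] is a lower bound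
in [X] greater than [y], a contradiction ([Cb_regular]). *)

(** * Lattices of functions with uniform convergence on the sets of a cover *)

(** Closure under unions makes the uniform balls on the members a base of
neighborhoods; singletons make the topology finer than pointwise convergence. *)
Record directed_cover (T : Type) := DirectedCover {
  members :> set T -> Prop ;
  members1 : forall x, members [set x] ;
  membersU : forall A B, members A -> members B -> members (A `|` B) ;
  members0 : members set0
}.

(** Boundedness on the members of the cover is what makes scalar multiplication
continuous for uniform convergence on them. *)
Record function_lattice (R : realType) (T : Type) (F : directed_cover T) :=
  FunctionLattice {
  funs :> (T -> R) -> Prop ;
  funs0 : funs (fun=> 0) ;
  funsD : forall f g, funs f -> funs g -> funs (fun x => f x + g x) ;
  funsZ : forall (a : R) f, funs f -> funs (fun x => a * f x) ;
  funs_max : forall f g, funs f -> funs g ->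
    funs (fun x => Num.max (f x) (g x)) ;
  funs_bounded : forall f S, funs f -> F S ->
    exists M, forall x, S x -> `|f x| <= M
}.

Section Lattice.
Context (R : realType) (T : Type) (F : directed_cover T)
  (L : function_lattice R F).

Definition in_funs : {pred T -> R} := fun f => `[< L f >].

Lemma in_funs_submod : submod_closed in_funs.
Proof.
split=> [|a f g]; first exact/asboolP/funs0.
move=> /asboolP Lf /asboolP Lg; apply/asboolP.
exact: (funsD (funsZ a Lf) Lg).
Qed.

HB.instance Definition _ :=
  GRing.isSubmodClosed.Build R (T -> R) in_funs
    (GRing.submod_closed_semi in_funs_submod).

Record latfun := LatFun { latval :> T -> R ; latvalP : latval \in in_funs }.

HB.instance Definition _ := [isSub for latval].
HB.instance Definition _ := [Choice of latfun by <:].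
HB.instance Definition _ := [SubChoice_isSubLmodule of latfun by <:].

Implicit Types f g h : latfun.

Lemma latfunP f : L f. Proof. exact/asboolP/latvalP. Qed.

Definition mklatfun (f : T -> R) (Lf : L f) : latfun := LatFun (asboolT Lf).

Lemma latfun_ext f g : f =1 g -> f = g.
Proof. by move=> fg; apply/val_inj/funext. Qed.

Lemma latfunD f g x : (f + g) x = f x + g x. Proof. by []. Qed.
Lemma latfunN f x : (- f) x = - f x. Proof. by []. Qed.
Lemma latfunB f g x : (f - g) x = f x - g x. Proof. by []. Qed.
Lemma latfunZ (a : R) f x : (a *: f) x = a * f x. Proof. by []. Qed.
Lemma latfun0 x : (0 : latfun) x = 0. Proof. by []. Qed.
Definition latfunE := (latfunD, latfunN, latfunB, latfunZ, latfun0).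

Definition latfun_le f g := `[< forall x, f x <= g x >].

Lemma latfun_le_refl : reflexive latfun_le.
Proof. by move=> f; apply/asboolP. Qed.

Lemma latfun_le_anti : antisymmetric latfun_le.
Proof.
move=> f g /andP[/asboolP fg /asboolP gf]; apply: latfun_ext => x.
by apply/le_anti; rewrite fg gf.
Qed.

Lemma latfun_le_trans : transitive latfun_le.
Proof.
move=> g f h /asboolP fg /asboolP gh; apply/asboolP => x.
exact: le_trans (fg x) (gh x).
Qed.

HB.instance Definition _ := Order.Le_isPOrder.Build ring_display latfun
  latfun_le_refl latfun_le_anti latfun_le_trans.

Lemma latfun_leP f g : reflect (forall x, f x <= g x) (f <= g).
Proof. exact: asboolP. Qed.

Definition latfun_join f g := mklatfun (funs_max (latfunP f) (latfunP g)).
Definition latfun_meet f g := - latfun_join (- f) (- g).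

Lemma latfun_meetE f g x : latfun_meet f g x = Num.min (f x) (g x).
Proof. by rewrite latfunE /= -oppr_min opprK. Qed.

Fact latfun_lerD2r f g h : g <= h -> g + f <= h + f.
Proof.
by move=> /latfun_leP gh; apply/latfun_leP => x; rewrite !latfunE lerD2r.
Qed.

Fact latfun_scaler_ge0 (a : R) f : 0 <= a -> 0 <= f -> 0 <= a *: f.
Proof.
move=> a0 /latfun_leP f0; apply/latfun_leP => x.
by rewrite latfunE mulr_ge0 ?f0.
Qed.

Fact latfun_join_lex f g h : (latfun_join f g <= h) = (f <= h) && (g <= h).
Proof.
apply/latfun_leP/andP => [H|[/latfun_leP fh /latfun_leP gh] x].
  by split; apply/latfun_leP => x; have := H x; rewrite ge_max => /andP[].
by rewrite ge_max fh gh.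
Qed.

Fact latfun_meet_gex f g h : (h <= latfun_meet f g) = (h <= f) && (h <= g).
Proof.
apply/latfun_leP/andP => [H|[/latfun_leP fh /latfun_leP gh] x].
  by split; apply/latfun_leP => x; have := H x;
    rewrite latfun_meetE le_min => /andP[].
by rewrite latfun_meetE le_min fh gh.
Qed.

HB.instance Definition _ := POrderedZmodule_isVectorLattice.Build R latfun
  latfun_lerD2r latfun_scaler_ge0 latfun_join_lex latfun_meet_gex.

Definition ball_on f (S : set T) (e : R) : set latfun :=
  [set g | forall x, S x -> `|f x - g x| < e].

Definition latfun_nbhs f : set_system latfun :=
  [set U | exists S e, [/\ F S, 0 < e & ball_on f S e `<=` U]].

HB.instance Definition _ := hasNbhs.Build latfun latfun_nbhs.

Fact latfun_nbhs_filter f : ProperFilter (nbhs f).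
Proof.
apply: Build_ProperFilter_ex.
  move=> U [S [e [_ e0 /(_ f)fU]]]; exists f; apply: fU => x _.
  by rewrite subrr normr0.
split.
- by exists set0, 1; split => //; exact: members0.
- move=> U V [S [e [FS e0 SU]]] [S' [e' [FS' e'0 SV]]].
  exists (S `|` S'), (Num.min e e'); split; first exact: membersU.
    by rewrite lt_min e0.
  move=> g fg; split; [apply: SU|apply: SV] => x Sx.
    by have := fg x (or_introl Sx); rewrite lt_min => /andP[].
  by have := fg x (or_intror Sx); rewrite lt_min => /andP[].
- move=> U V UV [S [e [FS e0 SU]]]; exists S, e; split => //.
  exact: subset_trans UV.
Qed.

Fact latfun_nbhs_singleton f (U : set latfun) : nbhs f U -> U f.
Proof.
by move=> [S [e [_ e0 /(_ f)fU]]]; apply: fU => x _; rewrite subrr normr0.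
Qed.

(** The supremum on [S] of a function pointwise below [e] may equal [e], so
[ball_on f S e] need not be open.  It is however a neighborhood of every
point of [ball_on f S (e / 2)]. *)
Fact latfun_nbhs_nbhs f (U : set latfun) : nbhs f U -> nbhs f (nbhs^~ U).
Proof.
move=> [S [e [FS e0 SU]]]; exists S, (e / 2); split; rewrite ?divr_gt0//.
move=> g fg; exists S, (e / 2); split; rewrite ?divr_gt0//.
move=> h gh; apply: SU => x Sx; rewrite (splitr e).
by rewrite (le_lt_trans (ler_distD (g x) _ _))// ltrD ?fg ?gh.
Qed.

HB.instance Definition _ := Nbhs_isNbhsTopological.Build latfun
  latfun_nbhs_filter latfun_nbhs_singleton latfun_nbhs_nbhs.

Lemma nbhs_ball_on f S e : F S -> 0 < e -> nbhs f (ball_on f S e).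
Proof. by move=> FS e0; exists S, e; split. Qed.

Fact latfun_add_continuous : continuous (fun z : latfun * latfun => z.1 + z.2).
Proof.
move=> [f g] U [S [e [FS e0 SU]]] /=.
have e20 : 0 < e / 2 by rewrite divr_gt0.
exists (ball_on f S (e / 2), ball_on g S (e / 2)).
  by split; exact: nbhs_ball_on.
move=> [f' g'] [/= ff' gg']; apply: SU => x Sx; rewrite !latfunE.
rewrite opprD addrACA (splitr e) (le_lt_trans (ler_normD _ _))//.
by rewrite ltrD ?ff' ?gg'.
Qed.

Fact latfun_scale_continuous :
  continuous (fun z : R^o * latfun => z.1 *: z.2).
Proof.
move=> [a f] U [S [e [FS e0 SU]]] /=.
have [M fM] := funs_bounded (latfunP f) FS.
pose N := `|M| + 1; pose c := Num.min 1 (e / 2 / N).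
have N0 : 0 < N by rewrite /N ltr_wpDl.
have a0 : 0 < `|a| + 1 by rewrite ltr_wpDl.
have d0 : 0 < e / 2 / (`|a| + 1) by rewrite !divr_gt0.
have c0 : 0 < c by rewrite lt_min ltr01 !divr_gt0.
exists (ball (a : R^o) c, ball_on f S (e / 2 / (`|a| + 1))).
  by split; [exact: nbhsx_ballx|exact: nbhs_ball_on].
move=> [b g] [/=]; rewrite /ball /= lt_min => /andP[ab1 ab] fg.
apply: SU => x Sx; rewrite !latfunE.
(* [f] is bounded on [S] by [N], and [b] by [`|a| + 1]. *)
have -> : a * f x - b * g x = (a - b) * f x + b * (f x - g x) by ring.
rewrite (splitr e) (le_lt_trans (ler_normD _ _))// ltr_leD// normrM.
  rewrite (@le_lt_trans _ _ (`|a - b| * N))//.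
    rewrite ler_wpM2l// (le_trans (fM x Sx))// /N.
    by rewrite (le_trans (ler_norm _))// lerDl.
  by rewrite -ltr_pdivlMr.
rewrite (@le_trans _ _ ((`|a| + 1) * (e / 2 / (`|a| + 1))))//.
  rewrite ler_pM// ?ltW ?fg//.
  have -> : b = a - (a - b) by ring.
  by rewrite (le_lt_trans (ler_normB _ _))// ltrD2l.
by rewrite mulrC divfK// gt_eqF.
Qed.

HB.instance Definition _ := PreTopologicalNmodule_isTopologicalNmodule.Build
  latfun latfun_add_continuous.
HB.instance Definition _ := TopologicalNmodule_isTopologicalLmodule.Build
  R latfun latfun_scale_continuous.

Lemma latfun_hausdorff : hausdorff_space latfun.
Proof.
move=> f g fg; apply: latfun_ext => x; apply: contrapT => /eqP fgx.
have e0 : 0 < `|f x - g x| / 2 by rewrite divr_gt0// normr_gt0 subr_eq0.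
have [h [fh gh]] := fg _ _ (nbhs_ball_on f (members1 F x) e0)
  (nbhs_ball_on g (members1 F x) e0).
have := ler_distD (h x) (f x) (g x).
rewrite leNgt => /negP; apply; rewrite [ltRHS]splitr ltrD ?fh//.
by rewrite distrC gh.
Qed.

Lemma latfun_modulusE f x : modulus f x = `|f x|.
Proof. exact: maxrN. Qed.

Lemma solid_ball_on S e : solid (ball_on 0 S e).
Proof.
move=> f g /latfun_leP fg ge x Sx; rewrite latfun0 sub0r normrN.
apply: le_lt_trans (ge x Sx); rewrite latfun0 sub0r normrN.
by rewrite -!latfun_modulusE.
Qed.

Lemma convex_ball_on f S e :
  convex_set (ball_on f S e : set (convex_lmodType latfun)).
Proof.
apply/convex_setW => g h; rewrite !inE => fg fh k k0 k1; rewrite inE => x Sx.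
have -> : f x - conv k g h x
    = k%:num * (f x - g x) + (1 - k%:num) * (f x - h x).
  by rewrite (_ : conv k g h x = k%:num * g x + (1 - k%:num) * h x)//; ring.
rewrite (le_lt_trans (ler_normD _ _))// !normrM.
rewrite (gtr0_norm k0) (@gtr0_norm _ (1 - k%:num)) ?subr_gt0//.
have -> : e = k%:num * e + (1 - k%:num) * e by ring.
by rewrite ltrD// ltr_pM2l ?subr_gt0// ?fg ?fh.
Qed.

Lemma latfun_locally_convex_solid : locally_convex_solid latfun.
Proof.
split=> U [S [e [FS e0 SU]]]; exists (ball_on 0 S e); split => //.
- exact: nbhs_ball_on.
- exact: solid_ball_on.
- exact: nbhs_ball_on.
- exact: convex_ball_on.
Qed.

End Lattice.

(** * The completion as a closure under approximation *)

Section Completion.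
Context (R : realType) (T : Type) (F : directed_cover T)
  (L : function_lattice R F).

Definition approximable (f : T -> R) :=
  forall S e, F S -> 0 < e ->
    exists2 g, L g & forall x, S x -> `|f x - g x| < e.

Lemma approximable_sub f : L f -> approximable f.
Proof. by move=> Lf S e _ e0; exists f => // x _; rewrite subrr normr0. Qed.

Lemma approximableD f g : approximable f -> approximable g ->
  approximable (fun x => f x + g x).
Proof.
move=> Lf Lg S e FS e0; have e20 : 0 < e / 2 by rewrite divr_gt0.
have [f' Lf' ff'] := Lf S _ FS e20; have [g' Lg' gg'] := Lg S _ FS e20.
exists (fun x => f' x + g' x); first exact: funsD.
move=> x Sx; rewrite opprD addrACA (splitr e) (le_lt_trans (ler_normD _ _))//.
by rewrite ltrD ?ff' ?gg'.
Qed.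

Lemma approximableZ a f : approximable f -> approximable (fun x => a * f x).
Proof.
move=> Lf S e FS e0; have a0 : 0 < `|a| + 1 by rewrite ltr_wpDl.
have [f' Lf' ff'] := Lf S _ FS (divr_gt0 e0 a0).
exists (fun x => a * f' x); first exact: funsZ.
move=> x /ff'; rewrite ltr_pdivlMr// -mulrBr normrM => lte.
by apply: le_lt_trans lte; rewrite mulrC ler_wpM2l// lerDl.
Qed.

Lemma dist_max (a b c d : R) :
  `|Num.max a b - Num.max c d| <= Num.max `|a - c| `|b - d|.
Proof.
rewrite le_max; have [] := leP a b; have [] := leP c d => cd ab; last 1 first.
- by rewrite lexx.
- by rewrite lexx orbT.
- have [h|h] := leP c b; apply/orP; [right|left].
    by rewrite !ger0_norm; lra.
  by rewrite !ler0_norm; lra.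
- have [h|h] := leP d a; apply/orP; [left|right].
    by rewrite !ger0_norm; lra.
  by rewrite !ler0_norm; lra.
Qed.

Lemma approximable_max f g : approximable f -> approximable g ->
  approximable (fun x => Num.max (f x) (g x)).
Proof.
move=> Lf Lg S e FS e0.
have [f' Lf' ff'] := Lf S _ FS e0; have [g' Lg' gg'] := Lg S _ FS e0.
exists (fun x => Num.max (f' x) (g' x)); first exact: funs_max.
move=> x Sx; rewrite (le_lt_trans (dist_max _ _ _ _))//.
by rewrite gt_max ff' ?gg'.
Qed.

Lemma approximable_bounded f S : approximable f -> F S ->
  exists M, forall x, S x -> `|f x| <= M.
Proof.
move=> Lf FS; have [g Lg fg] := Lf S _ FS ltr01.
have [M gM] := funs_bounded Lg FS; exists (1 + M) => x Sx.
have -> : f x = (f x - g x) + g x by ring.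
by rewrite (le_trans (ler_normD _ _))// lerD ?gM// ltW ?fg.
Qed.

Definition uniform_closure : function_lattice R F :=
  FunctionLattice (approximable_sub (funs0 L)) approximableD approximableZ
    approximable_max approximable_bounded.

Local Notation X := (latfun L).
Local Notation Xhat := (latfun uniform_closure).

Definition latfun_incl (f : X) : Xhat :=
  @mklatfun _ _ _ uniform_closure f (approximable_sub (latfunP f)).

Fact latfun_incl_linear : linear latfun_incl.
Proof. by move=> a f g; apply: latfun_ext. Qed.

HB.instance Definition _ :=
  GRing.isLinear.Build R X Xhat *:%R latfun_incl latfun_incl_linear.

Lemma latfun_incl_inj : injective latfun_incl.
Proof.
by move=> f g /(congr1 (@latval _ _ _ _)) fg; apply: latfun_ext => x;
  have := congr1 (@^~ x) fg.
Qed.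

(** Cauchy filters converge at each point because singletons are in the cover.
Letting one argument of the Cauchy condition tend to the pointwise limit shows
that the convergence is uniform on every member, which also makes the limit
approximable. *)
Lemma uniform_closure_complete : tvs_complete Xhat.
Proof.
move=> G GG Gc.
have Gx x : cvg ((fun f : Xhat => f x) @ G).
  apply/cauchy_cvgP/cauchy_ballP => e e0.
  have [[A B] /= [GA GB] AB] := Gc _ (nbhs_ball_on 0 (members1 F x) e0).
  exists ((fun f : Xhat => f x) @` A, (fun f : Xhat => f x) @` B).
    by split => /=; [apply: filterS GA|apply: filterS GB] => f ?; exists f.
  move=> [_ _] [/= [f Af <-] [g Bg <-]].
  by have := AB (f, g) (conj Af Bg) x erefl; rewrite latfun0 sub0r normrN.
pose l x := lim ((fun f : Xhat => f x) @ G).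
have Gl S (e : R) : F S -> 0 < e ->
    G [set f | forall x, S x -> `|l x - f x| < e].
  move=> FS e0; have e20 : 0 < e / 2 by rewrite divr_gt0.
  have [[A B] /= [GA GB] AB] := Gc _ (nbhs_ball_on 0 FS e20).
  apply: filterS GA => f Af x Sx; apply: (@le_lt_trans _ _ (e / 2)); last first.
    by rewrite ltr_pdivrMr// ltr_pMr// ltr1n.
  have lc : `|g x - f x| @[g --> G] --> `|l x - f x|.
    by apply: cvg_norm; apply: cvgB; [exact: Gx|exact: cvg_cst].
  rewrite -(cvg_lim (@Rhausdorff R) lc); apply: limr_le.
    by apply/cvg_ex; exists `|l x - f x|.
  apply: filterS GB => g Bg; have := AB (f, g) (conj Af Bg) x Sx.
  by rewrite latfun0 sub0r normrN distrC => /ltW.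
have Ll : uniform_closure l.
  move=> S e FS e0; have e20 : 0 < e / 2 by rewrite divr_gt0.
  have [f lf] := filter_ex (Gl S _ FS e20).
  have [g Lg fg] := latfunP f S _ FS e20.
  exists g => // x Sx; rewrite (splitr e).
  by rewrite (le_lt_trans (ler_distD (f x) _ _))// ltrD ?fg ?lf.
exists (mklatfun Ll) => U [S [e [FS e0 SU]]].
exact: filterS (Gl S e FS e0).
Qed.

(** The inclusion pulls balls back to balls; an open [U] of [X] is therefore the
trace of the union of all open sets whose trace lies in [U]. *)
Lemma latfun_incl_embedding : topological_embedding latfun_incl.
Proof.
split; first exact: latfun_incl_inj.
move=> U; split=> [|[V oV <-]]; last first.
  rewrite openE => f /= Vf.
  have [S [e [FS e0 SV]]] := open_nbhs_nbhs (conj oV Vf).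
  by exists S, e; split => // g fg; exact: SV.
move=> oU.
pose Vs := [set W : set Xhat | open W /\ latfun_incl @^-1` W `<=` U].
exists (\bigcup_(W in Vs) W); first by apply: bigcup_open => W [].
apply/seteqP; split=> [f [W [_ WU]] /= Wf|f Uf]; first exact: WU.
have [S [e [FS e0 SU]]] := open_nbhs_nbhs (conj oU Uf).
exists (ball_on (latfun_incl f) S e)^°.
  split; first exact: open_interior.
  by move=> g /interior_subset fg; apply: SU.
exact: nbhs_ball_on.
Qed.

Lemma latfun_incl_dense : dense (range latfun_incl).
Proof.
move=> U [f Uf] oU; have [S [e [FS e0 SU]]] := open_nbhs_nbhs (conj oU Uf).
have [g Lg fg] := latfunP f S _ FS e0.
by exists (latfun_incl (mklatfun Lg)); split; [exact: SU|exists (mklatfun Lg)].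
Qed.

(** A nonnegative function is approximated by the positive parts of its
approximants, because [Num.max _ 0] does not increase distances. *)
Lemma latfun_cone_closure :
  [set f : Xhat | 0 <= f] = closure (latfun_incl @` [set f : X | 0 <= f]).
Proof.
apply/seteqP; split=> f /=.
  move=> /latfun_leP f0 U [S [e [FS e0 SU]]].
  have [g Lg fg] := latfunP f S _ FS e0.
  have Lg0 := funs_max Lg (funs0 L).
  exists (latfun_incl (mklatfun Lg0)); split.
    exists (mklatfun Lg0) => //; apply/latfun_leP => x.
    by rewrite le_max lexx orbT.
  apply: SU => x Sx /=; rewrite -[f x](max_l (f0 x)).
  rewrite (le_lt_trans (dist_max _ _ _ _))// gt_max fg//.
  by rewrite latfun0 subrr normr0.
move=> cf; apply/latfun_leP => x; rewrite latfun0 leNgt; apply/negP => fx0.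
have e0 : 0 < - f x by rewrite oppr_gt0.
have [_ [[g /latfun_leP /(_ x) g0 <-]]] :=
  cf _ (nbhs_ball_on f (members1 F x) e0).
move=> /(_ x erefl) /=; rewrite ltNge => /negP; apply.
by rewrite latfun0 in g0; rewrite ler0_norm; lra.
Qed.

Lemma latfun_incl_completion : is_completion (latfun_incl : {linear X -> Xhat}).
Proof.
split.
- exact: latfun_hausdorff.
- exact: uniform_closure_complete.
- exact: latfun_incl_embedding.
- exact: latfun_incl_dense.
- exact: latfun_cone_closure.
Qed.

End Completion.

(** * Facts on vector lattices, sequences and dense sets *)

Section NegationDuality.
Context (R : realType) (Z : vectorLatticeType R).
Implicit Types (Y A : set Z) (x y : Z).

Lemma vlat_lerN2 x y : x <= y -> - y <= - x.
Proof.
by move=> /(vlat_lerD2r (- x - y)); rewrite addNKr (addrC (- x)) addNKr.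
Qed.

(** Negation exchanges suprema and infima, so only infima have to be checked. *)
Lemma regular_sublattice_inf Y : vector_sublattice Y ->
  (forall A y, A `<=` Y -> infimum_in Y A y -> infimums A y) ->
  regular_sublattice Y.
Proof.
move=> subY infY; split=> // A y _ AY; split; last exact: infY.
have [_ _ YZ _ _] := subY.
have YN x : Y x -> Y (- x) by rewrite -scaleN1r; exact: YZ.
move=> [Yy Ay yA].
have NAY : -%R @` A `<=` Y by move=> _ [x /AY Yx <-]; exact: YN.
have [|lby uby] := infY _ (- y) NAY.
  split; first exact: YN.
    by move=> _ [x Ax <-]; exact/vlat_lerN2/Ay.
  move=> u Yu Au; rewrite -[u]opprK; apply/vlat_lerN2/yA; first exact: YN.
  move=> x Ax; rewrite -[x]opprK; apply/vlat_lerN2/Au; first by exists x.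
split=> // u Au; rewrite -[y]opprK -[u]opprK; apply/vlat_lerN2/uby.
by move=> _ [x Ax <-]; exact/vlat_lerN2/Au.
Qed.

End NegationDuality.

(** Away from the limit, only finitely many terms of the sequence remain. *)
Lemma closed_cvg_range (T : topologicalType) (u : nat -> T) (l : T) :
  hausdorff_space T -> u @ \oo --> l -> closed (l |` range u).
Proof.
move=> hT ul p clp; apply: contrapT => pE.
have pl : p != l by apply/eqP => pl; apply: pE; left.
move: (hT); rewrite open_hausdorff => /(_ p l pl).
move=> [[/= U V] [/set_mem Up /set_mem Vl] [oU oV /eqP UV]].
have [N _ NV] := ul V (open_nbhs_nbhs (conj oV Vl)).
suff : closure (u @` `I_N) p.
  have /closure_id <- : closed (u @` `I_N).
    apply: (accessible_finite_set_closed.1 (hausdorff_accessible hT)).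
    exact/finite_image/finite_II.
  by move=> [n _ np]; apply: pE; right; exists n.
move=> W pW.
have [z [Az [Wz Uz]]] := clp _ (filterI pW (open_nbhs_nbhs (conj oU Up))).
exists z; split=> //.
have nV : ~ V z by move=> Vz; have : (U `&` V) z by []; rewrite UV.
case: Az => [zl|[n _ nz]]; first by rewrite zl in nV.
exists n => //=; rewrite ltnNge; apply/negP => Nn; apply: nV.
by rewrite -nz; exact: NV.
Qed.

Lemma continuous_ge_dense (T : topologicalType) (R : realType) (f : T -> R)
    (H U : set T) (c : R) : continuous f -> dense H -> open U ->
  (forall x, U x -> H x -> c <= f x) -> forall x, U x -> c <= f x.
Proof.
move=> cf dH oU cfH x Ux; rewrite leNgt; apply/negP => fxc.
have [||y [[Uy fyc] Hy]] := dH (U `&` f @^-1` [set r | r < c]).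
- by exists x.
- by apply: openI => //; apply: open_comp => // z _; exact: cf.
by have := cfH y Uy Hy; rewrite leNgt fyc.
Qed.

(** * Bounded continuous functions split along a set and its complement *)

Section Example.
Context (R : realType) (G : set R).

(** On such a set the indicator of [G] agrees with a continuous function,
although [G] and its complement may both be dense. *)
Definition split_closed (S : set R) := closed (S `&` G) /\ closed (S `\` G).

Lemma closed_subset1 (x : R) (A : set R) : A `<=` [set x] -> closed A.
Proof.
move=> Ax.
apply: (accessible_finite_set_closed.1 (hausdorff_accessible (@Rhausdorff R))).
exact: sub_finite_set Ax (finite_set1 x).
Qed.

Lemma split_closed1 x : split_closed [set x].
Proof. by split; apply: (@closed_subset1 x) => y []. Qed.

Lemma split_closedU A B :
  split_closed A -> split_closed B -> split_closed (A `|` B).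
Proof.
move=> [AG AnG] [BG BnG]; split; first by rewrite setIUl; exact: closedU.
by rewrite setDUl; exact: closedU.
Qed.

Lemma split_closed0 : split_closed set0.
Proof. by split; rewrite ?set0I ?set0D; exact: closed0. Qed.

Definition split_cover : directed_cover R :=
  DirectedCover split_closed1 split_closedU split_closed0.

Definition bounded_continuous (f : R -> R) :=
  continuous f /\ exists M, forall x, `|f x| <= M.

Lemma bounded_continuous0 : bounded_continuous (fun=> 0).
Proof. by split; [move=> x; exact: cvg_cst|exists 0 => x; rewrite normr0]. Qed.

Lemma bounded_continuousD f g : bounded_continuous f -> bounded_continuous g ->
  bounded_continuous (fun x => f x + g x).
Proof.
move=> [cf [M fM]] [cg [N gN]]; split.
  by move=> x; apply: cvgD; [exact: cf|exact: cg].
by exists (M + N) => x; rewrite (le_trans (ler_normD _ _))// lerD.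
Qed.

Lemma bounded_continuousZ a f : bounded_continuous f ->
  bounded_continuous (fun x => a * f x).
Proof.
move=> [cf [M fM]]; split.
  by move=> x; apply: cvgM; [exact: cvg_cst|exact: cf].
by exists (`|a| * M) => x; rewrite normrM ler_wpM2l.
Qed.

Lemma bounded_continuous_max f g : bounded_continuous f ->
  bounded_continuous g -> bounded_continuous (fun x => Num.max (f x) (g x)).
Proof.
move=> [cf [M fM]] [cg [N gN]]; split.
  move=> x; exact: (continuous_max (cf x) (cg x)).
exists (Num.max M N) => x; have [_|_] := leP (f x) (g x).
  by rewrite le_max gN orbT.
by rewrite le_max fM.
Qed.

Lemma bounded_continuous_bounded f S : bounded_continuous f ->
  split_cover S -> exists M, forall x, S x -> `|f x| <= M.
Proof. by move=> [_ [M fM]] _; exists M. Qed.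

Definition Cb : function_lattice R split_cover :=
  FunctionLattice bounded_continuous0 bounded_continuousD bounded_continuousZ
    bounded_continuous_max bounded_continuous_bounded.

Lemma Cb_separation (A B : set R) : closed A -> closed B -> A `&` B = set0 ->
  exists f, [/\ Cb f, forall x, 0 <= f x <= 1, forall x, A x -> f x = 0
              & forall x, B x -> f x = 1].
Proof.
move=> cA cB AB.
have sep : uniform_separator A B.
  apply: (normal_separatorP (R := R)).1 cA cB AB.
  exact: (@pseudometric_normal R).
have fr x : 0 <= (Urysohn A B x : R) <= 1.
  have := @Urysohn_range R R A B _ (ex_intro2 _ _ x I erefl).
  by rewrite /= in_itv.
exists (Urysohn A B : R -> R); split.
- split; first exact: Urysohn_continuous.
  by exists 1 => x; have /andP[f0 f1] := fr x; rewrite ger0_norm.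
- exact: fr.
- by move=> x Ax; apply: (Urysohn_sub0 sep); exists x.
- by move=> x Bx; apply: (Urysohn_sub1 sep); exists x.
Qed.

Lemma approximable_indic : approximable Cb \1_G.
Proof.
move=> S e [SG SnG] e0.
have [|f [Cf _ f0 f1]] := Cb_separation SnG SG.
  by rewrite setDE setIACA setICl setI0.
exists f => // x Sx; have [Gx|nGx] := pselect (G x).
  by rewrite f1// indicE mem_set// subrr normr0.
by rewrite f0// indicE memNset// subrr normr0.
Qed.

(** Otherwise some sequence in [H] tends to [x] while [f] stays at distance [e]
from [f x] along it.  With its limit it forms a closed subset of [H], on which
[f] is a uniform limit of continuous functions: a contradiction. *)
Lemma approximable_near (H : set R) f x e : H = G \/ H = ~` G ->
  approximable Cb f -> H x -> 0 < e ->
  \forall y \near x, H y -> `|f x - f y| < e.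
Proof.
move=> HG Af Hx e0; apply: contrapT => nnear.
have /choice[u Hu] (n : nat) : exists y,
    [/\ `|x - y| < n.+1%:R^-1, H y & e <= `|f x - f y|].
  apply: contrapT => nex; apply: nnear.
  have n0 : 0 < n.+1%:R^-1 :> R by rewrite invr_gt0.
  apply/nbhs_ballP; exists n.+1%:R^-1 => //= y xy Hy.
  by rewrite ltNge; apply/negP => ey; apply: nex; exists y.
have ux : u @ \oo --> x.
  apply/cvgrPdist_lt => d d0; near=> n.
  have [un _ _] := Hu n; apply: (lt_trans un).
  by near: n; exact: near_infty_natSinv_lt (PosNum d0).
pose S := x |` range u.
have SH : S `<=` H by move=> _ [->//|[n _ <-]]; have [] := Hu n.
have cS : closed S by apply: closed_cvg_range => //; exact: Rhausdorff.
have FS : split_cover S.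
  case: HG => HG; rewrite HG in SH; split.
  - by rewrite (setIidPl _ _).2.
  - by rewrite (_ : S `\` G = set0) ?setD_eq0//; exact: closed0.
  - rewrite (_ : S `&` G = set0); first exact: closed0.
    exact/disjoints_subset.
  - by rewrite setDE (setIidPl _ _).2.
have e30 : 0 < e / 3 by rewrite divr_gt0.
have [g [cg _] fg] := Af S _ FS e30.
have /cvgrPdist_lt /(_ _ e30) [N _ gN] : g (u n) @[n --> \oo] --> g x.
  exact: (continuous_cvg _ (cg x) ux).
have [_ _] := Hu N; rewrite leNgt => /negP; apply.
have gx := fg x (or_introl erefl).
have gu : `|f (u N) - g (u N)| < e / 3 by apply: fg; right; exists N.
have gN' := gN N (leqnn N).
have -> : f x - f (u N) = (f x - g x) + (g x - g (u N)) - (f (u N) - g (u N)).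
  by ring.
have := ler_normB (f x - g x + (g x - g (u N))) (f (u N) - g (u N)).
have := ler_normD (f x - g x) (g x - g (u N)).
by rewrite /= in gN'; lra.
Unshelve. all: by end_near. Qed.

Local Notation X := (latfun Cb).
Local Notation Xhat := (latfun (uniform_closure Cb)).
Local Notation J := (@latfun_incl _ _ _ Cb).

Context (dG : dense G) (dGC : dense (~` G)).

Lemma Cb_sublattice : vector_sublattice (range J).
Proof.
split.
- by exists 0 => //; apply: latfun_ext.
- by move=> _ _ [f _ <-] [g _ <-]; exists (f + g) => //; apply: latfun_ext.
- by move=> a _ [f _ <-]; exists (a *: f) => //; apply: latfun_ext.
- by move=> _ _ [f _ <-] [g _ <-]; exists (vjoin f g) => //; apply: latfun_ext.
- by move=> _ _ [f _ <-] [g _ <-]; exists (vmeet f g) => //; apply: latfun_ext.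
Qed.

Lemma Cb_regular : regular_sublattice (range J).
Proof.
apply: (regular_sublattice_inf Cb_sublattice) => A _ AJ [[y _ <-] lby yA].
split=> // z lbz; apply/latfun_leP => x; rewrite leNgt; apply/negP => yzx.
have [H [HG Hx]] : exists H, (H = G \/ H = ~` G) /\ H x.
  by have [Gx|nGx] := pselect (G x); [exists G|exists (~` G)]; split; auto.
pose h := z - J y; pose c := h x / 2.
have hx : 0 < h x by rewrite /h latfunB subr_gt0.
have c0 : 0 < c by rewrite divr_gt0.
have := approximable_near HG (latfunP h) Hx c0.
rewrite /prop_near1 nbhsE => -[U [oU Ux] hU].
have [|||b [Cfb b01 bU bx]] := @Cb_separation (~` U) [set x].
- exact: open_closedC.
- exact: (@closed_subset1 x).
- by apply/seteqP; split => // t [/= nUt tx]; rewrite tx in nUt.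
(* The bump [b'] vanishes off [U], is at most [c] and equals [c] at [x]. *)
pose b' := mklatfun (funsZ c Cfb).
have lbb : lbound A (J (y + b')).
  move=> a Aa; have [a' _ aE] := AJ a Aa.
  have ya := lby a Aa; have za := lbz a Aa.
  rewrite -aE in ya za *; move/latfun_leP: ya => ya; move/latfun_leP: za => za.
  have [ca _] := latfunP a'; have [cy _] := latfunP y.
  have cU : forall t, U t -> c <= a' t - y t.
    apply: (@continuous_ge_dense _ _ (fun t => a' t - y t) H) => //.
    - by move=> t; apply: cvgB; [exact: ca|exact: cy].
    - by case: HG => ->.
    - move=> t Ut Ht; have zat : z t <= a' t := za t.
      have hE s : h s = z s - y s by [].
      by have := hU t Ut Ht; rewrite ltr_norml /c !hE => /andP[_]; lra.
  apply/latfun_leP => t; change (y t + c * b t <= a' t).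
  have [Ut|nUt] := pselect (U t); last by rewrite bU// mulr0 addr0; exact: ya.
  have /andP[_ b1] := b01 t; have := cU t Ut.
  by have := ler_piMr (ltW c0) b1; lra.
have /latfun_leP /(_ x) := yA _ (ex_intro2 _ _ _ I erefl) lbb.
change (~ y x + c * b x <= y x).
by rewrite bx// mulr1 gerDl leNgt c0.
Qed.

Lemma Cb_not_order_dense : ~ order_dense (range J).
Proof.
pose z : Xhat := @mklatfun _ _ _ (uniform_closure Cb) _ approximable_indic.
move=> /(_ z) [|_ [y _ <-] /andP[/lt_le_trans y0 /latfun_leP yz]].
  have [g [_ Gg]] := dG (ex_intro _ 0 I) openT.
  rewrite lt_neqAle; apply/andP; split.
    apply/eqP => z0; have := congr1 (@^~ g \o @latval _ _ _ _) z0.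
    by rewrite /= indicE mem_set// => /eqP; rewrite eq_sym oner_eq0.
  by apply/latfun_leP => x; rewrite latfun0 /= indicE; case: (_ \in _).
have [cy _] := latfunP y.
have y0' : forall x, setT x -> 0 <= - y x.
  apply: (@continuous_ge_dense _ _ (fun t => - y t) (~` G)) => //.
  - by move=> t; apply: cvgN; exact: cy.
  - exact: openT.
  - by move=> t _ nGt; have := yz t; rewrite /= indicE memNset// oppr_ge0.
suff : J y <= 0 by move=> /y0; rewrite ltxx.
by apply/latfun_leP => x; rewrite latfun0 /= -oppr_ge0 y0'.
Qed.

End Example.

(** The irrationals are a countable intersection of dense open sets, so Baire's
theorem applies. *)
Lemma dense_irrational (R : realType) : dense (@irrational R).
Proof.
have [B oB ->] := @irrational_Gdelta R.
exact: (@Baire _ R).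
Qed.

Theorem theorem6p3 (R : realType) :
  exists (X Xhat : topVectorLatticeType R) (J : {linear X -> Xhat}),
    [/\ hausdorff_space X,
        locally_convex_solid X,
        is_completion J,
        regular_sublattice (range J)
      & ~ order_dense (range J)].
Proof.
exists (latfun (Cb (@rational R))), (latfun (uniform_closure (Cb rational))),
  (latfun_incl (L := Cb rational)); split.
- exact: latfun_hausdorff.
- exact: latfun_locally_convex_solid.
- exact: latfun_incl_completion.
- exact: (Cb_regular (@dense_rat R) (@dense_irrational R)).
- exact: (Cb_not_order_dense (@dense_rat R) (@dense_irrational R)).
Qed.
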